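(* Let $H$ be a hypergraph and $B\subseteq V(H)$. Then $B$ is a lazy burning set for $H$ if and only if the hypergraph $H\setminus B$ is degenerate.
   Context: A hypergraph $H$ consists of a finite vertex set $V(H)$ and a finite collection $E(H)$ of nonempty subsets of $V(H)$. Lazy burning: a set $B\subseteq V(H)$ is burned initially; in each subsequent round every unburned vertex $v$ for which some hyperedge $h\ni v$ has $h\setminus\{v\}$ entirely burned becomes burned (so vertices of singleton hyperedges burn immediately). $B$ is a lazy burning set if eventually all vertices burn. For $U\subseteq V(H)$, the (weakly) induced subhypergraph $H[U]$ has vertex set $U$ and hyperedges $\{h\cap U: h\in E(H),\ h\cap U\neq\emptyset\}$; $H\setminus U:=H[V(H)\setminus U]$. The core $\mathrm{core}(H)$ is the induced subhypergraph $H[U]$ for the largest $U\subseteq V(H)$ such that every hyperedge of $H[U]$ has cardinality at least $2$ (equivalently, the result of repeatedly deleting the vertex of a singleton hyperedge until none remain). $H$ is degenerate if $\mathrm{core}(H)$ has no vertices. *)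

(* Defs.v *)
From mathcomp Require Import all_boot.
Set Implicit Arguments.
Unset Strict Implicit.
Unset Printing Implicit Defensive.

(* The vertex set is a subset of an ambient finite type, so that a hypergraph
   and its induced subhypergraphs all live in the same type. *)
Record hypergraph (T : finType) := Hypergraph {
  vertices : {set T};
  edges : {set {set T}};
  edges_wf : forall h, h \in edges -> h != set0 /\ h \subset vertices
}.

Section Hypergraph.
Context {T : finType}.
Implicit Types (H : hypergraph T) (B U W : {set T}).

Fact induced_wf H U h :
  h \in [set g :&: U | g in edges H & g :&: U != set0] ->
  h != set0 /\ h \subset vertices H :&: U.
Proof.
case/imsetP=> g; rewrite inE => /andP[gE gU] ->; split=> //.
by apply: setSI; case: (edges_wf gE).
Qed.

(* Total in U: the vertex set is U itself whenever U \subset vertices H. *)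
Definition induced H U : hypergraph T := Hypergraph (@induced_wf H U).

Definition hyper_del H U : hypergraph T := induced H (vertices H :\: U).

Definition no_small_edge H : bool := [forall h in edges H, 1 < #|h|].

(* The largest U is obtained as the union of all candidates; core_setP shows
   that this union is itself a candidate, hence the greatest one. *)
Definition core_set H : {set T} :=
  \bigcup_(U : {set T} | (U \subset vertices H) && no_small_edge (induced H U)) U.

Lemma core_setP H :
  [/\ core_set H \subset vertices H,
      no_small_edge (induced H (core_set H)) &
      forall U, U \subset vertices H -> no_small_edge (induced H U) ->
        U \subset core_set H].
Proof.
have coreU U : U \subset vertices H -> no_small_edge (induced H U) ->
    U \subset core_set H.
  by move=> sUV nU; apply: bigcup_sup; rewrite sUV.
split=> //; first by apply/bigcupsP => U /andP[].
apply/forall_inP => h /imsetP[g]; rewrite inE => /andP[gE /set0Pn[x]].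
rewrite inE => /andP[xg /bigcupP[U /andP[sUV nU] xU]] ->.
have gU : g :&: U \in edges (induced H U).
  apply/imsetP; exists g => //; rewrite inE gE /=.
  by apply/set0Pn; exists x; rewrite inE xg.
apply: leq_trans (forall_inP nU _ gU) (subset_leq_card _).
by apply: setIS; apply: coreU.
Qed.

Definition core H : hypergraph T := induced H (core_set H).

Definition degenerate H : Prop := vertices (core H) = set0.

Definition burn_step H B : {set T} :=
  B :|: [set v in vertices H |
           [exists h in edges H, (v \in h) && (h :\ v \subset B)]].

Definition lazy_burning_set H B : Prop :=
  B \subset vertices H /\ exists n, iter n (burn_step H) B = vertices H.

End Hypergraph.

(* Main.v *)
(* Call U stalled when no edge meets U in exactly one vertex. A stalled set
   avoiding the burned set never catches fire, the unburned vertices form a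
   stalled set once burning stops, and the core of a hypergraph is its greatest
   stalled set. *)
Require Import Defs.
From mathcomp Require Import all_boot.

Set Implicit Arguments.
Unset Strict Implicit.
Unset Printing Implicit Defensive.

Definition stalled {T : finType} (H : hypergraph T) (U : {set T}) : bool :=
  [forall h in edges H, #|h :&: U| != 1].

(** As long as [f] moves the set, the complement strictly shrinks, so induction on a bound for its
    size terminates. *)
Lemma iter_extensive_fix (T : finType) (f : {set T} -> {set T}) (A : {set T}) :
  (forall X : {set T}, X \subset f X) -> exists n, f (iter n f A) = iter n f A.
Proof.
move=> fS; elim: {A}_.+1 {-2}A (ltnSn #|~: A|) => // m IHm A ltAm.
have [fA|fA] := eqVneq (f A) A; first by exists 0.
have [|n fn] := IHm (f A); last by exists n.+1; rewrite iterSr.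
apply: leq_trans (proper_card _) ltAm.
by rewrite properC properEneq eq_sym fA fS.
Qed.

Section Burning.
Context {T : finType}.
Implicit Types (H : hypergraph T) (B U : {set T}).

(** Edges of [induced H U] are the nonempty traces on [U]; for these, size above 1 and size other
    than 1 agree, while an empty trace never violates [stalled]. *)
Lemma no_small_edge_induced H U : no_small_edge (induced H U) = stalled H U.
Proof.
apply/forall_inP/forall_inP => [nU g gE | sU h].
  apply/negP => /eqP gU1.
  suff /nU : g :&: U \in edges (induced H U) by rewrite gU1.
  by apply/imsetP; exists g => //; rewrite inE gE -card_gt0 gU1.
case/imsetP=> g; rewrite inE => /andP[gE gU0] ->.
by rewrite ltn_neqAle eq_sym sU // card_gt0.
Qed.

Lemma stalled_hyper_del H B U :
  U \subset vertices H :\: B -> stalled (hyper_del H B) U = stalled H U.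
Proof.
move=> sU; have IU g : g :&: (vertices H :\: B) :&: U = g :&: U.
  by rewrite -setIA (setIidPr sU).
apply/forall_inP/forall_inP => [sG g gE | sH h].
  (* An edge with no vertex outside [B] disappears from [hyper_del H B], but its trace on [U] is
     empty, so it is harmless. *)
  have [g0|g0] := eqVneq (g :&: (vertices H :\: B)) set0.
    by rewrite -IU g0 set0I cards0.
  by rewrite -IU; apply/sG/imsetP; exists g; rewrite // inE gE.
by case/imsetP=> g; rewrite inE => /andP[gE _] ->; rewrite IU sH.
Qed.

Lemma degenerateP H :
  degenerate H <->
  (forall U, U \subset vertices H -> stalled H U -> U = set0).
Proof.
have [sV nC maxC] := core_setP H.
rewrite /degenerate /= (setIidPr sV); split=> [C0 U sU nU | empty].
  by apply/eqP; rewrite -subset0 -C0 maxC // no_small_edge_induced.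
by apply: empty; rewrite // -no_small_edge_induced.
Qed.

Lemma burn_stepS H B : B \subset burn_step H B.
Proof. exact: subsetUl. Qed.

Lemma burn_step_sub H B :
  B \subset vertices H -> burn_step H B \subset vertices H.
Proof.
by move=> sB; rewrite subUset sB; apply/subsetP=> v; rewrite inE => /andP[].
Qed.

(** If an edge [h] ignited [v] in [U], the rest of [h] would lie in [B], away from [U], and [h]
    would meet [U] in [v] alone. *)
Lemma burn_step_disjoint H B U :
  stalled H U -> [disjoint B & U] -> [disjoint burn_step H B & U].
Proof.
move=> /forall_inP sU dBU; apply/pred0P => v; apply/negP => /=.
case/andP=> + vU; rewrite !inE => /orP[vB|/andP[_]].
  by rewrite (disjointFr dBU vB) in vU.
case/exists_inP=> h hE /andP[vh sB]; case/negP: (sU h hE).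
apply/cards1P; exists v; apply/setP=> x; rewrite !inE.
have [->|xv] := eqVneq x v; first by rewrite vh.
apply/negP => /andP[xh xU].
have xB : x \in B by rewrite (subsetP sB) // !inE xv.
by rewrite (disjointFr dBU xB) in xU.
Qed.

Lemma stalled_unburned H B :
  burn_step H B = B -> stalled H (vertices H :\: B).
Proof.
move=> fixB; apply/forall_inP => h hE; apply/negP => /cards1P[v hv].
have : v \in h :&: (vertices H :\: B) by rewrite hv set11.
rewrite !inE => /and3P[vh vB vV]; case/negP: vB.
rewrite -fixB !inE vV; apply/orP; right; apply/exists_inP; exists h => //.
rewrite vh; apply/subsetP=> x; rewrite !inE => /andP[xv xh].
(* Since [h] stays within the vertex set, a vertex of [h] outside [B] lies in the trace, which is
   just [v]. *)
have [_ /subsetP /(_ x xh) xV] := edges_wf hE.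
apply: contraR xv => xB.
by rewrite -in_set1 -hv !inE xh xB xV.
Qed.

End Burning.

Theorem theorem3p5 (T : finType) (H : hypergraph T) (B : {set T})
  (hB : B \subset vertices H) :
  lazy_burning_set H B <-> degenerate (hyper_del H B).
Proof.
have VG : vertices (hyper_del H B) = vertices H :\: B.
  exact/setIidPr/subsetDl.
split=> [[_ [n burnt]] | /degenerateP].
  apply/degenerateP => U; rewrite VG => sU; rewrite stalled_hyper_del // => nU.
  (* [U] avoids [B] and, being stalled, every later burned set; once all vertices burn, nothing is
     left for [U]. *)
  have : [disjoint iter n (burn_step H) B & U].
    elim: n {burnt} => [|n IHn] /=; last exact: burn_step_disjoint.
    by move: sU; rewrite subsetD disjoint_sym => /andP[].
  rewrite burnt disjoint_sym => dU; apply/eqP; rewrite -subset0.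
  have sUV := subset_trans sU (subsetDl _ _).
  by rewrite -(setIidPl sUV) (disjoint_setI0 dU).
rewrite VG => empty; split=> //.
have [n fixn] := iter_extensive_fix B (burn_stepS H).
(* [C] is where burning stops: its unburned complement is stalled and avoids [B], so [empty] applies
   to it. *)
exists n; set C := iter n _ B in fixn *.
have sBC : B \subset C.
  by rewrite /C; elim: (n) => //= k IHk; apply: subset_trans IHk (burn_stepS _ _).
have sCV : C \subset vertices H.
  by rewrite /C; elim: (n) => //= k; apply: burn_step_sub.
have sU : vertices H :\: C \subset vertices H :\: B by apply: setDS.
apply/eqP; rewrite eqEsubset sCV -setD_eq0; apply/eqP/empty => //.
by rewrite stalled_hyper_del // stalled_unburned.
Qed.
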